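(* Let $d$ be an even positive integer and $q$ an odd prime power with $q>(d-1)^2$. Then $s_2(q,d)=0$.
   Context: A polynomial $f\in\mathbb{F}_q[t]$ is $2$-superirreducible if $f(g(t))$ is irreducible in $\mathbb{F}_q[t]$ for every $g\in\mathbb{F}_q[t]$ of degree $1$ or $2$. $s_2(q,d)$ denotes the number of monic $2$-superirreducible polynomials of degree $d$ in $\mathbb{F}_q[t]$. *)

(* Defs.v *)
From mathcomp Require Import all_boot all_algebra.
From mathcomp Require Import boolp.

Set Implicit Arguments.
Unset Strict Implicit.
Unset Printing Implicit Defensive.

Import GRing.Theory.
Local Open Scope ring_scope.

(* [size g] is one more than the degree of [g], and [f \Po g] is f(g(t)). *)
Definition superirreducible2 (F : fieldType) (f : {poly F}) : Prop :=
  forall g : {poly F},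
    size g = 2%N \/ size g = 3%N -> irreducible_poly (f \Po g).

(* The polynomials of degree [d] all lie in the finite type of polynomials of
   size at most [d.+1]. The count depends only on [#|F|] and [d], since finite
   fields of the same cardinality are isomorphic. *)
Definition s2 (F : finFieldType) (d : nat) : nat :=
  #|[set f : {poly_(d.+1) F} |
      [&& size (f : {poly F}) == d.+1, (f : {poly F}) \is monic
        & `[< superirreducible2 (f : {poly F}) >]]]|.

(* Main.v *)
Require Import Defs.
From HB Require Import structures.
From mathcomp Require Import all_boot all_order all_algebra all_field.
From mathcomp Require boolp.
From mathcomp Require Import ring zify.

(** Let [f] be 2-superirreducible of even degree [d], [q = #|F|], and [al] a
    root of [f]. If [f(c)] were a square for some [c] in [F], then so would be
    [al - c] in [F(al)], and [f(t^2 + c)] would be reducible. Hence [f(c)] is a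
    nonsquare for all [c], so that the character sum of [f] over [F] is [-q].
    Weil's bound for this sum is [(d - 1) sqrt q], which forces
    [q <= (d - 1)^2].

    For Weil's bound, let [chi(h)] be the quadratic character of [h(al)] in
    [F(al)]. The sums [a_n] of [chi] over the monic polynomials of degree [n]
    vanish for [n >= d], and reciprocity together with unique factorization
    shows that the character sums [s_k] of [f] over the extensions of degree
    [k] are related to them by Newton's identities. So [- s_k] is the [k]-th
    power sum of the at most [d - 1] reciprocal roots of [\sum_n a_n u^n].
    Stepanov's method, with an auxiliary polynomial built from [R]-th powers
    where [R = q^(k/2)], gives [|s_k| = O(R)] for even [k]; hence these
    reciprocal roots have absolute value at most [sqrt q]. *)

Set Implicit Arguments.
Unset Strict Implicit.
Unset Printing Implicit Defensive.

Import Order.TTheory GRing.Theory Num.Theory.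
Local Open Scope ring_scope.

(** * Power sums and Newton's identities *)

(** Logarithmic differentiation, [X L' / L = - \sum_k p_k X^k], with denominators cleared and cut
    off after degree [n]: each factor contributes a geometric series, which telescopes against
    [1 - w X]. *)
Lemma newton_prod_dvdp (R : fieldType) (ws : seq R) (n : nat) :
  let L := \prod_(w <- ws) (1 - w%:P * 'X) in
  let P := \sum_(k < n) (\sum_(w <- ws) w ^+ k.+1)%:P * 'X^(k.+1) in
  'X^(n.+1) %| 'X * L^`() + P * L.
Proof.
cbv zeta; elim: ws => [|w ws IHs].
  rewrite big_nil derivC mulr0 add0r mulr1 big1 ?dvdp0 // => k _.
  by rewrite big_nil polyC0 mul0r.
rewrite big_cons derivM /=.
set L := \prod_(_ <- ws) _ in IHs *.
set P := (X in X * L) in IHs.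
have -> : \sum_(k < n) (\sum_(z <- w :: ws) z ^+ k.+1)%:P * 'X^(k.+1) =
    \sum_(k < n) (w%:P * 'X) ^+ k.+1 + P.
  rewrite /P -big_split /=; apply: eq_bigr => k _.
  by rewrite big_cons polyCD mulrDl exprMn polyC_exp.
have tel : (\sum_(k < n) (w%:P * 'X) ^+ k.+1) * (1 - w%:P * 'X) =
    w%:P * 'X - (w%:P * 'X) ^+ n.+1 :> {poly R}.
  elim: (n) => [|m IHm]; first by rewrite big_ord0 mul0r expr1 subrr.
  by rewrite big_ord_recr /= mulrDl IHm (exprS _ m.+1); ring.
have -> : (1 - w%:P * 'X)^`() = - w%:P.
  by rewrite derivB -polyC1 derivM !derivC derivX mul0r !add0r mulr1.
set T := (\sum_(k < n) _) in tel *.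
have -> : 'X * (- w%:P * L + (1 - w%:P * 'X) * L^`()) +
    (T + P) * ((1 - w%:P * 'X) * L) =
    - (w%:P ^+ n.+1 * L * 'X^(n.+1)) + (1 - w%:P * 'X) * ('X * L^`() + P * L).
  transitivity ('X * (- w%:P * L) + (T * (1 - w%:P * 'X)) * L +
     (1 - w%:P * 'X) * ('X * L^`() + P * L)); first by ring.
  by rewrite tel exprMn; ring.
by rewrite dvdp_addr ?dvdpNr dvdp_mull.
Qed.

Lemma newton_coef (R : fieldType) (ws : seq R) (n : nat) :
  let L := \prod_(w <- ws) (1 - w%:P * 'X) in
  n%:R * L`_n = - \sum_(k < n) (\sum_(w <- ws) w ^+ k.+1) * L`_(n - k.+1).
Proof.
move=> L; apply/eqP; rewrite -addr_eq0.
have /dvdpP[Q] := newton_prod_dvdp ws n.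
rewrite -/L => /(congr1 (fun p : {poly R} => p`_n)).
rewrite coefMXn ltnSn coefD coefXM coef_deriv mulr_suml coef_sum => eq0.
rewrite -[X in _ == X]eq0; apply/eqP; congr (_ + _).
  by case: (n) => [|m] /=; rewrite ?mul0r // mulr_natl.
by apply: eq_bigr => k _; rewrite -mulrA coefCM coefXnM ltnNge ltn_ord.
Qed.

(** Bernoulli's inequality makes the powers of any [x > 1] unbounded. *)
Lemma geometric_growth (x C : algC) :
  0 <= x -> (forall k : nat, x ^+ k <= C) -> x <= 1.
Proof.
move=> x0 le_xC; have [//|lt1x] := real_leP (ger0_real x0) (real1 _).
have d0 : 0 < x - 1 by rewrite subr_gt0.
have bern k : 1 + k%:R * (x - 1) <= x ^+ k.
  elim: k => [|k IHk]; first by rewrite mul0r addr0 expr0.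
  rewrite exprS; apply: le_trans (ler_wpM2l x0 IHk).
  have -> : x * (1 + k%:R * (x - 1)) =
      1 + k.+1%:R * (x - 1) + k%:R * (x - 1) ^+ 2 by rewrite -natr1; ring.
  by rewrite lerDl mulr_ge0 ?ler0n // exprn_ge0 // ltW.
have C0 : 0 <= C by apply: le_trans (le_xC 0); rewrite ler01.
have [k lt_k] : exists k : nat, C / (x - 1) < k%:R.
  by exists (Num.bound (C / (x - 1))); rewrite archi_boundP // divr_ge0 // ltW.
have := le_trans (bern k) (le_xC k).
rewrite ltr_pdivrMr // in lt_k.
by move=> /(lt_le_trans (ltr_pwDl ltr01 (ltW lt_k))); rewrite ltxx.
Qed.

(* Lagrange interpolation recovers each [z ^+ k] from consecutive power sums. *)
Lemma power_sum_root_bound (zs : seq algC) (B C : algC) : 0 < B ->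
  (forall k : nat, `|\sum_(z <- zs) z ^+ k| <= C * B ^+ k) ->
  {in zs, forall z, `|z| <= B}.
Proof.
move=> B0 bnd z0 z0s.
(* [P] vanishes at all listed values except [z0], so weighting shifted power sums by the
   coefficients of [P] isolates [z0 ^+ k], up to the multiplicity of [z0]. *)
pose P := \prod_(z <- undup zs | z != z0) ('X - z%:P).
have P0 z : z \in zs -> z != z0 -> P.[z] = 0.
  move=> zs_z ne; rewrite /P horner_prod big_mkcond (bigD1_seq z) ?mem_undup //=.
    by rewrite ne hornerXsubC subrr mul0r.
  exact: undup_uniq.
have Pz0 : P.[z0] != 0.
  rewrite /P horner_prod prodf_seq_neq0; apply/allP => z _ /=.
  by apply/implyP => ne; rewrite hornerXsubC subr_eq0 eq_sym.
have key k : \sum_(i < size P) P`_i * \sum_(z <- zs) z ^+ (k + i) =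
    (count_mem z0 zs)%:R * (z0 ^+ k * P.[z0]).
  under eq_bigr do rewrite mulr_sumr.
  rewrite exchange_big /=.
  transitivity (\sum_(z <- zs) z ^+ k * P.[z]).
    apply: eq_bigr => z _; rewrite horner_coef mulr_sumr.
    by apply: eq_bigr => i _; rewrite exprD; ring.
  rewrite -sum1_count natr_sum mulr_suml [RHS]big_mkcond /=.
  rewrite big_seq [RHS]big_seq; apply: eq_bigr => z zs_z.
  by have [->|ne] := eqVneq z z0; rewrite ?mul1r // P0 // mulr0.
have m0 : 0 < (count_mem z0 zs)%:R :> algC by rewrite ltr0n -has_count has_pred1.
pose C' := (\sum_(i < size P) `|P`_i| * C * B ^+ i) / `|P.[z0]|.
have: `|z0| / B <= 1.
  apply: (@geometric_growth _ C') => [|k]; first by rewrite divr_ge0 // ltW.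
  rewrite expr_div_n ler_pdivrMr ?exprn_gt0 // /C' mulrAC ler_pdivlMr ?normr_gt0 //.
  rewrite -normrX -normrM.
  apply: (@le_trans _ _ `|(count_mem z0 zs)%:R * (z0 ^+ k * P.[z0])|).
    by rewrite [leRHS]normrM ler_peMl // normr_nat ler1n -(ltr0n algC).
  rewrite -key; apply: le_trans (ler_norm_sum _ _ _) _.
  rewrite mulr_suml; apply: ler_sum => i _; rewrite normrM.
  rewrite -!mulrA ler_wpM2l // -exprD addnC; exact: bnd.
by rewrite ler_pdivrMr // mul1r.
Qed.

(** [\prod (1 - w X)] is the reversal of [\prod (X - w)]. The guard keeps truncated subtraction from
    returning the constant coefficient for large [n]. *)
Lemma coef_prod_1subCX (R : fieldType) (ws : seq R) (n : nat) :
  (\prod_(w <- ws) (1 - w%:P * 'X))`_n =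
  if (n <= size ws)%N then (\prod_(w <- ws) ('X - w%:P))`_(size ws - n) else 0.
Proof.
elim: ws n => [|w ws IHs] n; first by rewrite !big_nil !coef1; case: n.
have szM := size_prod_XsubC ws id.
rewrite !big_cons !mulrBl mul1r !coefB -mulrA !coefCM !coefXM !IHs /=.
have [->|n0] := posnP n.
  by rewrite !subn0 /= mulr0 subr0 [X in _ - _ * X]nth_default ?szM ?mulr0 ?subr0.
rewrite -subn1 subn_eq0 leq_subLR add1n.
have [->|ne_n] := eqVneq n (size ws).+1.
  by rewrite ltnn leqnn subn1 subnn /= subnn.
rewrite [(n <= (size ws).+1)%N]leq_eqVlt (negPf ne_n) ltnS /=.
have [le_n|lt_n] := leqP n (size ws); last by rewrite mulr0 subr0.
by rewrite subSn //= subnBA // addn1 subSn.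
Qed.

(** The numerical end of Weil's bound. The reciprocal roots of [\sum_n a_n u^n] have power sums
    [- s k]; bounding [s] at even indices bounds their squares, and [a 1] is minus the sum of
    [d - 1] of them. *)
Lemma newton_weil_bound (a s : nat -> int) (d q C : nat) : (0 < q)%N -> (0 < d)%N ->
  a 0%N = 1 -> (forall n, (d <= n)%N -> a n = 0) ->
  (forall n, n%:R * a n = \sum_(k < n) s k.+1 * a (n - k.+1)%N) ->
  (forall k, (0 < k)%N -> `|s k.*2| <= C%:R * q%:R ^+ k) ->
  a 1%N ^+ 2 <= d.-1%:R ^+ 2 * q%:R.
Proof.
move=> q0 d0 a0 a_d newton bnd.
(* The reversal of [\sum_n a_n u^n]: monic because [a 0 = 1], so its [d - 1] roots, zero allowed,
   are the reciprocal roots sought. *)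
pose M : {poly algC} := \poly_(i < d) (a (d.-1 - i)%N)%:~R.
have M_lead : M`_d.-1 = 1 by rewrite coef_poly ltn_predL d0 subnn a0.
have szM : size M = d.
  apply/eqP; rewrite eqn_leq size_poly leqNgt; apply/negP => lt_d.
  move: M_lead; rewrite nth_default => [/eqP|]; first by rewrite eq_sym oner_eq0.
  by rewrite -ltnS prednK.
have [ws Mws] := closed_field_poly_normal M.
rewrite lead_coefE szM M_lead scale1r in Mws.
have szws : size ws = d.-1 by rewrite -szM Mws size_prod_XsubC.
pose L := \prod_(w <- ws) (1 - w%:P * 'X).
have L_a n : L`_n = (a n)%:~R.
  rewrite coef_prod_1subCX -Mws szws coef_poly.
  have [le_n|lt_n] := leqP n d.-1; last by rewrite a_d // -(prednK d0).
  by rewrite (leq_ltn_trans (leq_subr _ _)) ?ltn_predL // subKn.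
(* In Newton's identities the last power sum has coefficient [a 0 = 1], so [a] determines the power
   sums recursively. *)
have ps n : (0 < n)%N -> \sum_(w <- ws) w ^+ n = - (s n)%:~R.
  elim/ltn_ind: n => -[//|n] IHn _.
  have := newton_coef ws n.+1; cbv zeta; rewrite -/L big_ord_recr L_a /= subnn L_a a0 mulr1.
  have -> : n.+1%:R * (a n.+1)%:~R = (n.+1%:R * a n.+1)%:~R :> algC by rewrite rmorphM rmorph_nat.
  rewrite newton big_ord_recr /= subnn a0 mulr1 rmorphD rmorph_sum /=.
  have -> : \sum_(k < n) (\sum_(w <- ws) w ^+ k.+1) * L`_(n.+1 - k.+1) =
      - \sum_(k < n) (s k.+1 * a (n.+1 - k.+1)%N)%:~R.
    rewrite -sumrN; apply: eq_bigr => k _.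
    by rewrite IHn ?ltnS // mulNr L_a rmorphM.
  by rewrite opprD opprK => /addrI ->; rewrite opprK.
have w_bnd : {in ws, forall w, `|w| <= sqrtC q%:R}.
  move=> w ws_w.
  have: `|w ^+ 2| <= q%:R.
    (* The summand [d] covers [k = 0], where the power sum is [d - 1]. *)
    apply: (@power_sum_root_bound [seq w ^+ 2 | w <- ws] q%:R (C + d)%:R).
    - by rewrite ltr0n.
    - move=> k; rewrite big_map; under eq_bigr do rewrite -exprM.
      have [->|k0] := posnP k.
        rewrite muln0 expr0 mulr1; under eq_bigr do rewrite expr0.
        rewrite big_const_seq count_predT szws.
        rewrite iter_addr_0 normr_nat ler_nat; lia.
      rewrite mul2n ps ?double_gt0 // normrN -intr_norm.
      apply: le_trans (_ : (C%:R * q%:R ^+ k)%:~R <= _).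
        by rewrite ler_int bnd.
      rewrite rmorphM rmorphXn /= !rmorph_nat ler_wpM2r ?exprn_ge0 ?ler0n //.
      by rewrite ler_nat leq_addr.
    - exact: map_f.
    rewrite normrX -[X in _ <= X]sqrtCK ler_pXn2r ?nnegrE //.
    by rewrite sqrtC_ge0 ler0n.
have a1 : (a 1%N)%:~R = - \sum_(w <- ws) w :> algC.
  have := ps 1%N isT; under eq_bigr do rewrite expr1.
  by move=> ->; rewrite opprK -[a 1%N]mul1r (newton 1%N) big_ord1 a0 mulr1.
have le1 : `|(a 1%N)%:~R : algC| <= d.-1%:R * sqrtC q%:R.
  rewrite a1 normrN; apply: le_trans (ler_norm_sum _ _ _) _.
  apply: le_trans (_ : \sum_(w <- ws) sqrtC q%:R <= _).
    by rewrite big_seq [leRHS]big_seq; apply: ler_sum => w /w_bnd.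
  by rewrite big_const_seq count_predT szws iter_addr_0 mulr_natl.
rewrite -(ler_int algC) rmorphXn rmorphM rmorphXn /= !rmorph_nat.
rewrite -[q%:R]sqrtCK -exprMn -[leLHS]ger0_norm ?normrX ?ler_pXn2r ?nnegrE //.
  by rewrite mulr_ge0 ?ler0n // sqrtC_ge0 ler0n.
by rewrite -rmorphXn ler0z sqr_ge0.
Qed.

(** * Stepanov's method *)

(** A coefficient matrix with more rows than columns has a nonzero left kernel. *)
Lemma poly_dependence (K : fieldType) (J : finType) (P : J -> {poly K}) (D : nat) :
  (forall j, size (P j) <= D)%N -> (D < #|J|)%N ->
  exists2 v : J -> K, (exists j, v j != 0) & \sum_j v j *: P j = 0.
Proof.
move=> szP ltD; pose A := \matrix_(i < #|J|, k < D) (P (enum_val i))`_k.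
have /rowV0Pn[u /sub_kermxP uA u0] : kermx A != 0.
  rewrite kermx_eq0 /row_free; apply/eqP => rA.
  by have := rank_leq_col A; rewrite rA leqNgt ltD.
exists (fun j => u 0 (enum_rank j)).
  have /rV0Pn[i ui] := u0.
  by exists (enum_val i); rewrite enum_valK.
apply/polyP => k; rewrite coef0 coef_sum.
have [ltk|lek] := ltnP k D; last first.
  by rewrite big1 // => j _; rewrite coefZ nth_default ?mulr0 // (leq_trans (szP j)).
have /matrixP/(_ 0 (Ordinal ltk)) := uA; rewrite mxE [RHS]mxE => uA0; rewrite -[RHS]uA0.
rewrite (reindex (@enum_val J predT)) /=; last exact/onW_bij/enum_val_bij.
by apply: eq_bigr => i _; rewrite mxE coefZ enum_valK.
Qed.

(** The multiplicity is that of 0 in [p], the least exponent occurring in [p]; gaps among exponents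
    thus become gaps among multiplicities. *)
Lemma coef_mup_comp_XsubC (K : fieldType) (p : {poly K}) (a : K) :
  p != 0 -> p`_(mup a (p \Po ('X - a%:P))) != 0.
Proof.
move=> p0; have [m [u nu ->]] := multiplicity_XsubC p 0.
rewrite p0 /= in nu.
rewrite comp_polyM rmorphXn /= comp_polyB comp_polyX comp_polyC subr0 polyC0 subr0.
have nu' : ~~ root (u \Po ('X - a%:P)) a.
  by rewrite /root horner_comp hornerXsubC subrr.
rewrite mupMr // mup_XsubCX eqxx coefMXn ltnn subnn.
by rewrite -horner_coef0; exact: nu.
Qed.

Section Stepanov.
Variables (K : closedFieldType) (f : {poly K}) (al eps : K) (r d : nat).
Local Notation R := r.*2.+1.
Hypotheses (R_char : [pchar K].-nat R) (r_gt0 : (0 < r)%N).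
Hypotheses (size_f : size f = d.+1) (f_al : mup al f = 1%N).

Let M := (r + d.*2)%N.
Let be := al ^+ (R ^ 2).

(** The last base-[R] digit of an exponent is kept below [r], about [R / 2], which leaves room for
    the shift by [r + 1] caused by [f ^+ r.+1]. *)
Let expo (ij : 'I_M * 'I_r) := (ij.2 + ij.1 * R)%N.
Let gap (x : 'I_M * 'I_r -> K) : {poly K} := \sum_ij x ij *: 'X^(expo ij).

Let expo_mod ij : (expo ij %% R = ij.2)%N.
Proof.
rewrite /expo addnC modnMDl modn_small //.
by apply: leq_trans (ltn_ord ij.2) _; rewrite -addnn; lia.
Qed.

Let expo_inj : injective expo.
Proof.
move=> [i j] [i' j'] e.
have ej : j = j' by apply: val_inj; rewrite /= -(expo_mod (i, j)) -(expo_mod (i', j')) e.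
have := e; rewrite /expo /= ej => /addnI/eqP; rewrite eqn_pmul2r // => /eqP ei.
by congr (_, _); apply: val_inj.
Qed.

Let gap_coef x ij : (gap x)`_(expo ij) = x ij.
Proof.
rewrite coef_sum (bigD1 ij) //= coefZ coefXn eqxx mulr1 big1 ?addr0 // => ij' ne.
by rewrite coefZ coefXn (inj_eq expo_inj) eq_sym (negPf ne) mulr0.
Qed.

Let gap_mod x n : (gap x)`_n != 0 -> (n %% R < r)%N.
Proof.
apply: contraNT => nlt; rewrite coef_sum big1 // => ij _.
rewrite coefZ coefXn; case: eqP nlt => [->|]; last by rewrite mulr0.
by rewrite expo_mod ltn_ord.
Qed.

(* The two summands cannot cancel: modulo [R] the multiplicity of [al] in the
   first one lies in [0, r), in the second one in [r + 1, 2r]. *)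
Let stepanov_neq0 (x y : 'I_M * 'I_r -> K) ij :
  (x ij != 0) || (y ij != 0) ->
  gap x \Po ('X - al%:P) + f ^+ r.+1 * (gap y \Po ('X - al%:P)) != 0.
Proof.
move=> xy; apply/eqP => /eqP; rewrite addr_eq0 => /eqP eqAB.
have f0 : f != 0 by rewrite -size_poly_eq0 size_f.
have szX : size ('X - al%:P) != 1%N by rewrite size_XsubC.
have comp0 p : (p \Po ('X - al%:P) == 0) = (p == 0).
  by rewrite comp_poly2_eq0 // size_XsubC.
have eq0 : (gap x == 0) = (gap y == 0).
  by rewrite -comp0 eqAB oppr_eq0 mulf_eq0 expf_eq0 (negPf f0) /= comp0.
have [gy0|gy0] := eqVneq (gap y) 0.
  move: xy; rewrite -(gap_coef x) -(gap_coef y).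
  have /eqP -> : gap x == 0 by rewrite eq0 gy0.
  by rewrite gy0 coef0 eqxx.
have gx0 : gap x != 0 by rewrite eq0.
have := gap_mod (coef_mup_comp_XsubC al gx0).
have := gap_mod (coef_mup_comp_XsubC al gy0).
set v := mup al (gap y \Po _) => ltv.
have -> : mup al (gap x \Po ('X - al%:P)) = (r.+1 + v)%N.
  have mupX n : mup al (f ^+ n) = n.
    elim: n => [|n IHn]; first by rewrite mupNroot // root1.
    by rewrite exprS mupM ?expf_neq0 // f_al IHn add1n.
  rewrite eqAB -mulNr mupM ?oppr_eq0 ?expf_neq0 ?comp0 //.
  by rewrite -mulN1r mupMr ?mupX // -polyC1 -polyCN rootC oppr_eq0 oner_eq0.
have ltw : (r.+1 + v %% R < R)%N by move: ltv; lia.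
rewrite -modnDmr (modn_small ltw); lia.
Qed.

(** A nonzero auxiliary polynomial of degree about [R ^ 2 / 2] vanishes on [cs]. Its [R]-th power
    agrees on [cs] with polynomials of low degree, which linear algebra makes dependent. *)
Lemma stepanov_bound (cs : seq K) : uniq cs ->
  {in cs, forall c, c ^+ (R ^ 2) = c /\ f.[c] ^+ (R ^ 2)./2 = eps} ->
  ((size cs).*2 <= R ^ 2 + 10 * d * R)%N.
Proof.
move=> uniq_cs cs_eps.
(* Where [c ^+ (R ^ 2) = c], one has [(c - al) ^+ (R ^ 2) = c - be]; so [G ij] takes there the value
   of the [R]-th power of [(X - al) ^+ (expo ij)], with a much smaller degree. *)
pose G (ij : 'I_M * 'I_r) := ('X - al%:P) ^+ (ij.2 * R) * ('X - be%:P) ^+ ij.1.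
pose P (u : bool * ('I_M * 'I_r)) :=
  if u.1 then G u.2 else eps *: (f ^+ r.+1 * G u.2).
pose D := (d * r.+1 + (r.-1 * R + M))%N.
have f0 : f != 0 by rewrite -size_poly_eq0 size_f.
have szf n : size (f ^+ n) = (d * n).+1.
  by rewrite (polySpred (expf_neq0 n f0)) size_exp size_f.
have szG ij : (size (G ij) <= r.-1 * R + M)%N.
  rewrite /G size_monicM ?monic_neq0 ?monic_exp ?monicXsubC //.
  rewrite !size_exp_XsubC addnS /= addSn -addnS leq_add ?leq_mul2r //.
  by apply/orP; right; have := ltn_ord ij.2; lia.
have szP u : (size (P u) <= D)%N.
  rewrite /P; case: u => -[] ij /=; first by rewrite (leq_trans (szG _)) // leq_addl.
  rewrite (leq_trans (size_scale_leq _ _)) // (leq_trans (size_polyMleq _ _)) //.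
  by rewrite szf addSn leq_add2l szG.
(* The choice of [M] pays off here: [2 r M - D = 3 d r - 3 d + 1] is positive. *)
have ltD : (D < #|{: bool * ('I_M * 'I_r)}|)%N.
  rewrite !card_prod card_bool !card_ord /D /M; move: r_gt0.
  by rewrite -!muln2; case: (r) => // r' _ /=; nia.
have [xi [[b ij0] xi0] sum0] := poly_dependence szP ltD.
(* At a point [c] with [c ^+ (R ^ 2) = c], the [R]-th power of
   [A + f ^+ r.+1 * B] takes the same value as [\sum_u xi u *: P u]. *)
have root_ex z : exists x : K, x ^+ R == z.
  have /closed_rootP[x] : size ('X^R - z%:P) != 1%N by rewrite size_XnsubC.
  by rewrite /root !hornerE subr_eq0; exists x.
pose rt z := xchoose (root_ex z).
have rtK z : rt z ^+ R = z by apply/eqP/(xchooseP (root_ex z)).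
(* Taking [R]-th roots of the coefficients compensates for the [R]-th power, which is additive since
   [R] is a power of the characteristic. *)
pose x ij := rt (xi (true, ij)); pose y ij := rt (xi (false, ij)).
pose A := gap x \Po ('X - al%:P); pose B := gap y \Po ('X - al%:P).
have gapE w c : (gap w \Po ('X - al%:P)).[c] ^+ R =
    \sum_ij w ij ^+ R * ((c - al) ^+ (ij.2 * R) * (c - al) ^+ (R ^ 2 * ij.1)).
  have FD : {morph (fun z : K => z ^+ R) : a b / a + b}.
    by move=> a b'; rewrite exprDn_pchar.
  rewrite horner_comp hornerXsubC horner_sum (big_morph _ FD (expr0n _ _)).
  apply: eq_bigr => ij _; rewrite hornerZ hornerXn exprMn -exprM /expo mulnDl exprD.
  by rewrite -mulnA mulnn [(R ^ 2 * _)%N]mulnC.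
have root_g : all (root (A + f ^+ r.+1 * B)) cs.
  apply/allP => c /cs_eps[cQ cf].
  have alc : (c - al) ^+ (R ^ 2) = c - be.
    rewrite exprDn_pchar ?pnatX ?R_char // cQ; congr (_ + _).
    by rewrite exprNn -signr_odd oddX /= odd_double expr1 mulN1r.
  rewrite /root -[_ == 0]/((0 < R)%N && (_ == 0)) -expf_eq0 hornerD hornerM horner_exp.
  rewrite exprDn_pchar // exprMn !gapE -exprM.
  (* This splits off the Euler power of [f.[c]], equal to [eps], and leaves only [f ^+ r.+1]. *)
  have -> : (r.+1 * R = (R ^ 2)./2 + r.+1)%N.
    have -> : (R ^ 2 = (2 * (r * r) + 2 * r).*2.+1)%N by rewrite -!muln2; nia.
    by rewrite /= uphalf_double -muln2; nia.
  rewrite exprD cf.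
  have := congr1 (horner^~ c) sum0; rewrite /= horner0 horner_sum.
  have -> : \sum_u (xi u *: P u).[c] =
      \sum_ij (xi (true, ij) *: P (true, ij)).[c] +
      \sum_ij (xi (false, ij) *: P (false, ij)).[c].
    rewrite -(big_bool _ (fun b => \sum_ij (xi (b, ij) *: P (b, ij)).[c])) pair_bigA.
    by apply: eq_bigr => -[].
  move=> eq0; rewrite -[X in _ == X]eq0; apply/eqP; congr (_ + _).
    apply: eq_bigr => ij _; rewrite rtK hornerZ /P /G /= hornerM !horner_exp.
    by rewrite !hornerXsubC [(c - al) ^+ (R ^ 2 * _)]exprM alc.
  rewrite mulr_sumr; apply: eq_bigr => ij _.
  rewrite rtK hornerZ /P /G /= hornerZ !hornerM !horner_exp !hornerXsubC.
  by rewrite [(c - al) ^+ (R ^ 2 * _)]exprM alc; ring.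
have g0 : A + f ^+ r.+1 * B != 0.
  apply: (stepanov_neq0 (ij := ij0)); apply: contraR xi0.
  rewrite negb_or !negbK => /andP[/eqP x0 /eqP y0].
  by case: b; rewrite -[xi _]rtK -/(x ij0) -/(y ij0) ?x0 ?y0 expr0n.
have szgap w : (size (gap w \Po ('X - al%:P)) <= r + (M.-1) * R)%N.
  rewrite size_comp_poly2 ?size_XsubC //; apply: (leq_trans (size_sum _ _ _)).
  apply/bigmax_leqP => ij _; rewrite (leq_trans (size_scale_leq _ _)) // size_polyXn.
  rewrite /expo -addSn leq_add ?ltn_ord // leq_mul2r; apply/orP; right.
  by rewrite -ltnS (ltn_predK (ltn_ord ij.1)) ltn_ord.
have := max_poly_roots g0 root_g uniq_cs.
have : (size (A + f ^+ r.+1 * B)%R <= d * r.+1 + (r + (M.-1) * R))%N.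
  rewrite (leq_trans (size_polyD _ _)) // geq_max (leq_trans (szgap x)) ?leq_addl //=.
  by rewrite (leq_trans (size_polyMleq _ _)) // szf addSn leq_add2l szgap.
move=> le_g lt_cs; have le_cs := leq_trans lt_cs le_g.
(* The main term [r R], once doubled, is [R ^ 2 - R]; the remaining terms are absorbed by
   [10 d R]. *)
have : (((d * r.+1 + (r + M.-1 * R)).-1).*2 <= R ^ 2 + 10 * d * R)%N.
  rewrite /M; case: (r) r_gt0 => // r' _; rewrite addSn /= -!muln2 -mulnn.
  have := leq0n (d * r'); have := leq0n (r' * r'); lia.
by apply: leq_trans; rewrite leq_double -ltnS (leq_trans le_cs) // leqSpred.
Qed.
End Stepanov.

(** * Frobenius orbits in an algebraically closed extension *)

Section Frobenius.
Variables (F : finFieldType) (K : closedFieldType) (emb : {rmorphism F -> K}).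
Local Notation q := #|F|.
Local Notation "h ^i" := (map_poly emb h) (at level 2, format "h ^i").

Lemma q_gt1 : (1 < q)%N. Proof. exact: finRing_gt1. Qed.

Lemma qX_gt0 n : (0 < q ^ n)%N. Proof. by rewrite expn_gt0 ltnW ?q_gt1. Qed.

Lemma finField_card_pchar : exists p m, [/\ p \in [pchar K], q = (p ^ m)%N & (0 < m)%N].
Proof.
have [p p_pr pF] := finPcharP F.
exists p, (logn p q); have qE : q = (p ^ logn p q)%N := card_pprimeChar pF.
split=> //; first exact: (rmorph_pchar emb).
by case: (logn p q) qE q_gt1 => // ->.
Qed.

Lemma card_pchar_nat n : [pchar K].-nat (q ^ n)%N.
Proof.
have [p [m [pK qE m0]]] := finField_card_pchar.
by rewrite (eq_pnat _ (pcharf_eq pK)) qE -expnM pnatX pnat_id ?(pcharf_prime pK).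
Qed.

Lemma card_pchar_eq0 n : (0 < n)%N -> (q ^ n)%:R = 0 :> K.
Proof.
have [p [m [pK -> m0]]] := finField_card_pchar => n0.
by apply/eqP; rewrite -(dvdn_pcharf pK) -expnM dvdn_exp // muln_gt0 m0.
Qed.

Lemma frobD n (x y : K) : (x + y) ^+ (q ^ n) = x ^+ (q ^ n) + y ^+ (q ^ n).
Proof. by rewrite exprDn_pchar ?card_pchar_nat. Qed.

Lemma frobN n (x : K) : (- x) ^+ (q ^ n) = - x ^+ (q ^ n).
Proof.
by apply/eqP; rewrite -addr_eq0 -frobD addNr expr0n gtn_eqF ?qX_gt0 /= ?eqxx.
Qed.

Lemma frobB n (x y : K) : (x - y) ^+ (q ^ n) = x ^+ (q ^ n) - y ^+ (q ^ n).
Proof. by rewrite frobD frobN. Qed.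

Lemma frob_inj n : injective (fun x : K => x ^+ (q ^ n)).
Proof.
move=> x y /eqP; rewrite -subr_eq0 -frobB expf_eq0 => /andP[_].
by rewrite subr_eq0 => /eqP.
Qed.

Lemma frob_emb n a : emb a ^+ (q ^ n) = emb a.
Proof.
by elim: n => [|n IHn]; rewrite ?expr1 // expnSr exprM IHn -rmorphXn expf_card.
Qed.

Lemma frob_horner n (h : {poly F}) x : h^i.[x] ^+ (q ^ n) = h^i.[x ^+ (q ^ n)].
Proof.
rewrite !horner_coef size_map_poly (big_morph _ (@frobD n) (_ : 0 ^+ _ = 0)).
  apply: eq_bigr => i _.
  by rewrite exprMn coef_map /= frob_emb -!exprM mulnC.
by rewrite expr0n gtn_eqF ?qX_gt0.
Qed.

Lemma frob_fixed x : x ^+ q = x -> exists a, emb a = x.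
Proof.
move=> xq; have : root (('X^q - 'X)^i) x.
  by rewrite rmorphB /= map_polyXn map_polyX /root !hornerE xq subrr.
rewrite finField_genPoly rmorph_prod /= => /eqP; rewrite horner_prod => /eqP.
case/prodf_eq0=> a _; rewrite map_polyXsubC hornerXsubC subr_eq0 => /eqP ->.
by exists a.
Qed.

Definition emb_inv (x : K) : F := odflt 0 [pick a | emb a == x].

Lemma emb_invK x : x ^+ q = x -> emb (emb_inv x) = x.
Proof.
move=> /frob_fixed[a <-]; rewrite /emb_inv.
by case: pickP => [b /eqP//|/(_ a)]; rewrite eqxx.
Qed.

Lemma emb_inv0 : emb_inv 0 = 0.
Proof.
apply: (fmorph_inj emb); rewrite emb_invK ?rmorph0 //.
by rewrite expr0n gtn_eqF // ltnW ?q_gt1.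
Qed.

Lemma map_emb_invK (p : {poly K}) :
  (forall i, p`_i ^+ q = p`_i) -> (map_poly emb_inv p)^i = p.
Proof.
move=> pq; apply/polyP => i.
by rewrite coef_map /= coef_map_id0 ?emb_inv0 // emb_invK.
Qed.

(* Junk value at [n = 0], where the polynomial is zero. *)
Definition Froots n : seq K := sval (closed_field_poly_normal ('X^(q ^ n) - 'X)).

Lemma Froots_prod n : (0 < n)%N ->
  'X^(q ^ n) - 'X = \prod_(z <- Froots n) ('X - z%:P).
Proof.
move=> n0; rewrite /Froots; case: closed_field_poly_normal => rs /= eqp.
rewrite {1}eqp; suff -> : lead_coef ('X^(q ^ n) - 'X : {poly K}) = 1 by rewrite scale1r.
rewrite lead_coefDl ?lead_coefXn // size_polyN size_polyX size_polyXn ltnS.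
by have := ltn_exp2l 0 n q_gt1; rewrite expn0 n0.
Qed.

Lemma mem_Froots n x : (0 < n)%N -> (x \in Froots n) = (x ^+ (q ^ n) == x).
Proof.
by move=> n0; rewrite -root_prod_XsubC -Froots_prod // /root !hornerE subr_eq0.
Qed.

(** The derivative of [X^(q^n) - X] is [-1]. *)
Lemma Froots_uniq n : (0 < n)%N -> uniq (Froots n).
Proof.
move=> n0; rewrite -separable_prod_XsubC -Froots_prod // unlock.
rewrite derivB derivXn derivX -mulr_natl -polyC_natr card_pchar_eq0 //.
rewrite polyC0 mul0r sub0r.
by apply/Bezout_coprimepP; exists (0, -1); rewrite mul0r add0r mulrNN mulr1 eqpxx.
Qed.

Lemma size_Froots n : (0 < n)%N -> size (Froots n) = (q ^ n)%N.
Proof.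
move=> n0; apply: succn_inj; rewrite -(size_prod_XsubC _ id) -Froots_prod //.
rewrite size_polyDl ?size_polyXn // size_polyN size_polyX ltnS.
by have := ltn_exp2l 0 n q_gt1; rewrite expn0 n0.
Qed.

(** * Products over Frobenius orbits *)

Definition conjprod (b : K) (k : nat) : {poly K} :=
  \prod_(i < k) ('X - (b ^+ (q ^ i))%:P).

(** For [b] in [Froots k], the characteristic polynomial of [b] in the extension of degree [k],
    descended to [F]. *)
Definition Fconjprod (b : K) (k : nat) : {poly F} := map_poly emb_inv (conjprod b k).

Lemma size_conjprod b k : size (conjprod b k) = k.+1.
Proof. by rewrite size_prod_XsubC /index_enum -enumT size_enum_ord. Qed.

Lemma conjprod_monic b k : conjprod b k \is monic.
Proof. exact: monic_prod_XsubC. Qed.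

Lemma map_conjprod (phi : {rmorphism K -> K}) b k : (forall x, phi x = x ^+ q) ->
  map_poly phi (conjprod b k) = \prod_(i < k) ('X - (b ^+ (q ^ i.+1))%:P).
Proof.
move=> phiE; rewrite /conjprod rmorph_prod; apply: eq_bigr => i _.
by rewrite /= map_polyXsubC phiE -exprM -expnSr.
Qed.

(** Frobenius permutes the factors cyclically, hence fixes the coefficients. *)
Lemma FconjprodK b k : (0 < k)%N -> b \in Froots k -> (Fconjprod b k)^i = conjprod b k.
Proof.
move=> k0; rewrite mem_Froots // => /eqP bk; apply: map_emb_invK => i.
pose phi x : K := x ^+ (q ^ 1).
have phiB : zmod_morphism phi by exact: frobB.
have phiM : monoid_morphism phi by split=> [|x y]; rewrite /phi ?expr1n ?exprMn.
pose phi_r : {rmorphism K -> K} := HB.pack phi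
  (GRing.isZmodMorphism.Build K K phi phiB) (GRing.isMonoidMorphism.Build K K phi phiM).
have phiE x : phi_r x = x ^+ q by rewrite /= /phi expn1.
transitivity (map_poly phi_r (conjprod b k))`_i; first by rewrite coef_map; exact/esym/phiE.
rewrite (map_conjprod _ _ phiE) /conjprod.
case: k k0 bk => // k _ bk.
by rewrite big_ord_recr [in RHS]big_ord_recl /= bk expn0 expr1 mulrC.
Qed.

Lemma Fconjprod_monic b k : (0 < k)%N -> b \in Froots k -> Fconjprod b k \is monic.
Proof. by move=> k0 bk; rewrite -(map_monic emb) FconjprodK ?conjprod_monic. Qed.

Lemma size_Fconjprod b k : (0 < k)%N -> b \in Froots k -> size (Fconjprod b k) = k.+1.
Proof. by move=> k0 bk; rewrite -(size_map_poly emb) FconjprodK ?size_conjprod. Qed.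

Lemma root_conjprod b k : (0 < k)%N -> root (conjprod b k) b.
Proof.
case: k => // k _; rewrite /conjprod big_ord_recl expn0 expr1 rootM root_XsubC eqxx.
by [].
Qed.

Lemma Froots_sub b m k : (0 < m < k)%N ->
  b \in Froots m -> b \in Froots k -> b \in Froots (k - m).
Proof.
move=> /andP[m0 ltmk]; have k0 := ltn_trans m0 ltmk.
rewrite !mem_Froots ?subn_gt0 // => /eqP bm /eqP bk.
by rewrite -{2}bk -(subnKC (ltnW ltmk)) expnD exprM bm (subnKC (ltnW ltmk)).
Qed.

Lemma conjprod_split b m k : (0 < m)%N -> b \in Froots m -> (m <= k)%N ->
  conjprod b k = conjprod b m * conjprod b (k - m).
Proof.
move=> m0; rewrite mem_Froots // => /eqP bm lemk.
have [j ->] : exists j, k = (m + j)%N by exists (k - m)%N; rewrite subnKC.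
rewrite addKn /conjprod big_split_ord /=; congr (_ * _).
by apply: eq_bigr => i _; rewrite expnD exprM bm.
Qed.

(** The iterates of [b] under Frobenius are roots of [h], so two of the first [size h] coincide;
    injectivity of Frobenius then cancels the smaller exponent. *)
Lemma root_period (h : {poly F}) b : h != 0 -> root h^i b ->
  exists n, [/\ (0 < n)%N, (n < size h)%N & b \in Froots n].
Proof.
move=> h0 hb.
pose cs := [seq b ^+ (q ^ i) | i <- iota 0 (size h)].
have size_cs : size cs = size h by rewrite size_map size_iota.
have : ~~ uniq cs.
  apply/negP => ucs.
  have : all (root h^i) cs.
    apply/allP => _ /mapP[i _ ->].
    by rewrite /root -frob_horner (rootP hb) expr0n gtn_eqF ?qX_gt0 /= ?eqxx.
  move/max_poly_roots => /(_ _ ucs); rewrite map_poly_eq0 => /(_ h0).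
  by rewrite size_cs size_map_poly ltnn.
case/(uniqPn 0) => i [j] [ltij ltj].
rewrite size_cs in ltj; have lti := ltn_trans ltij ltj.
rewrite !(nth_map 0%N) ?size_iota // !nth_iota // !add0n => eqb.
exists (j - i)%N; rewrite subn_gt0 ltij (leq_ltn_trans (leq_subr _ _)) //.
split=> //; rewrite mem_Froots ?subn_gt0 //; apply/eqP.
by apply: (@frob_inj i); rewrite -exprM -expnD subnK // ltnW.
Qed.

Lemma min_period b n : (0 < n)%N -> b \in Froots n ->
  exists m, [/\ (0 < m <= n)%N, b \in Froots m,
    forall k, (0 < k)%N -> b \in Froots k -> (m <= k)%N &
    uniq [seq b ^+ (q ^ i) | i <- iota 0 m]].
Proof.
move=> n0 bn; have exn : exists k, (0 < k)%N && (b \in Froots k) by exists n; rewrite n0.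
case: (ex_minnP exn) => m /andP[m0 bm] minm; exists m; split=> //.
- by rewrite m0 minm // n0.
- by move=> k k0 bk; rewrite minm // k0.
rewrite map_inj_in_uniq ?iota_uniq // => i j.
rewrite !mem_iota !add0n /= => lti ltj.
wlog leij : i j lti ltj / (i <= j)%N.
  move=> wl; case/orP: (leq_total i j) => le eqb; first exact: wl.
  by apply/esym; exact: wl.
move=> eqb; apply/eqP; rewrite eqn_leq leij leqNgt; apply/negP => ltij.
have := minm (j - i)%N; rewrite subn_gt0 ltij mem_Froots ?subn_gt0 //=.
have -> : b ^+ (q ^ (j - i)) == b.
  by apply/eqP/(@frob_inj i); rewrite -exprM -expnD subnK.
by move=> /(_ isT); rewrite leqNgt (leq_ltn_trans (leq_subr _ _)).
Qed.

Lemma conjprod_seq b m :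
  conjprod b m = \prod_(z <- [seq b ^+ (q ^ i) | i <- iota 0 m]) ('X - z%:P).
Proof. by rewrite big_map -[in RHS](subn0 m) -[iota _ _]/(index_iota 0 m) big_mkord. Qed.

Lemma Fconjprod_dvd (h : {poly F}) b m : (0 < m)%N -> b \in Froots m ->
  uniq [seq b ^+ (q ^ i) | i <- iota 0 m] -> root h^i b -> Fconjprod b m %| h.
Proof.
move=> m0 bm ub hb; rewrite -(dvdp_map emb) FconjprodK // conjprod_seq.
apply: uniq_roots_dvdp; last by rewrite uniq_rootsE.
apply/allP => _ /mapP[i _ ->].
by rewrite /root -frob_horner (rootP hb) expr0n gtn_eqF ?qX_gt0 /= ?eqxx.
Qed.

Lemma mup_conjprod b m : (0 < m)%N ->
  uniq [seq b ^+ (q ^ i) | i <- iota 0 m] -> mup b (conjprod b m) = 1%N.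
Proof.
rewrite conjprod_seq; case: m => // m _ /=; rewrite expn0 expr1 => /andP[nb _].
rewrite big_cons mupMl ?root_prod_XsubC //.
by rewrite -['X - _]expr1 mup_XsubCX eqxx.
Qed.

(* A root [b] of exact period [m] has the polynomials [Fconjprod b k], with
   [m %| k], equal to the powers of its minimal polynomial. *)
Lemma mup_count (h : {poly F}) N b : h != 0 -> (size h <= N.+1)%N ->
  mup b h^i = (\sum_(1 <= k < N.+1) ((b \in Froots k) && (Fconjprod b k %| h)%R))%N.
Proof.
elim/ltn_ind: N h => N IHN h h0 szh.
have [hb|nhb] := boolP (root h^i b); last first.
  rewrite mupNroot // big_nat big1 // => k /andP[k0 _].
  case: (boolP (b \in _)) => //= bk; case: (boolP (_ %| _)) => //.
  rewrite -(dvdp_map emb) FconjprodK // => dv.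
  by case/negP: nhb; rewrite -dvdp_XsubCl (dvdp_trans _ dv) // dvdp_XsubCl root_conjprod.
have [n [n0 ltn bn]] := root_period h0 hb.
have [m [/andP[m0 lemn] bm minm ub]] := min_period n0 bn.
have /dvdpP[h1 eqh] := Fconjprod_dvd m0 bm ub hb.
have lemN : (m <= N)%N by rewrite -ltnS (leq_trans _ szh) // (leq_ltn_trans lemn).
have P0 : Fconjprod b m != 0 by rewrite monic_neq0 ?Fconjprod_monic.
have h10 : h1 != 0 by apply: contraNneq h0 => h10; rewrite eqh h10 mul0r.
have szh1 : (size h1 <= (N - m).+1)%N.
  move: szh; rewrite eqh size_mul // size_Fconjprod // addnS /=.
  by rewrite -subSn // leq_subRL 1?addnC // ltnW.
rewrite {1}eqh rmorphM /= mupM ?map_poly_eq0 // FconjprodK // mup_conjprod //.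
rewrite (IHN (N - m)%N) //; last by lia.
(* No index below the exact period [m] contributes, [m] itself contributes 1, and larger indices
   shifted down by [m] give the count for the quotient [h1]. *)
rewrite [RHS](big_cat_nat (n := m)) ?leqW //=.
have -> : (\sum_(1 <= k < m) ((b \in Froots k) && (Fconjprod b k %| h)%R) = 0)%N.
  rewrite big_nat big1 // => k /andP[k0 ltkm]; case: (boolP (b \in _)) => //= bk.
  by have := minm k k0 bk; rewrite leqNgt ltkm.
rewrite add0n.
rewrite [in RHS]big_ltn ?ltnS // bm {1}eqh dvdp_mull // [LHS]addnC; congr addn.
rewrite -[m.+1]add1n big_addn subSn // big_nat [RHS]big_nat; apply: eq_bigr => k /andP[k0 ltk].
have -> : (b \in Froots (k + m)) = (b \in Froots k).
  apply/idP/idP => bk; first by rewrite -(addnK m k) Froots_sub // m0 -{1}[m]add0n ltn_add2r.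
  move: bk bm; rewrite !mem_Froots ?addn_gt0 ?k0 // => /eqP bk /eqP bm'.
  by rewrite expnD exprM bk bm'.
case: (boolP (b \in _)) => //= bk.
have bkm : b \in Froots (k + m).
  move: bk bm; rewrite !mem_Froots ?addn_gt0 ?k0 // => /eqP bk /eqP bm'.
  by rewrite expnD exprM bk bm'.
have -> : Fconjprod b (k + m) = Fconjprod b k * Fconjprod b m.
  apply: (map_poly_inj emb); rewrite rmorphM /= !FconjprodK ?addn_gt0 ?k0 //.
  by rewrite (conjprod_split (k := k + m) m0 bm) ?leq_addl // addnK mulrC.
by rewrite eqh dvdp_mul2r.
Qed.

Lemma sum_mup (p : {poly K}) (B : seq K) : p != 0 -> uniq B ->
  (forall z, root p z -> z \in B) -> (\sum_(b <- B) mup b p)%N = (size p).-1.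
Proof.
move=> p0 uB rB; have [zs eqp] := closed_field_poly_normal p.
have lc0 : lead_coef p != 0 by rewrite lead_coef_eq0.
have mupp b : mup b p = count_mem b zs.
  rewrite eqp -mul_polyC mupMr ?rootC //; elim: (zs) => [|z s IHs] /=.
    by rewrite big_nil mupNroot // root1.
  rewrite big_cons mupM ?polyXsubC_eq0 ?monic_neq0 ?monic_prod_XsubC // IHs.
  by rewrite -['X - _]expr1 mup_XsubCX; case: eqP.
have zsB z : z \in zs -> z \in B.
  by move=> zsz; apply: rB; rewrite eqp rootZ // root_prod_XsubC.
have -> : (size p).-1 = size zs by rewrite eqp size_scale // size_prod_XsubC.
under eq_bigr do rewrite mupp.
elim: (zs) zsB => [|z s IHs] sB; first by rewrite big1.
rewrite /= big_split /= IHs; last by move=> x sx; rewrite sB // inE sx orbT.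
rewrite (bigD1_seq z) ?sB ?mem_head //= eqxx big1 ?addn0 ?add1n // => b.
by rewrite eq_sym => /negPf ->.
Qed.

End Frobenius.

(** * The quadratic character and its L-polynomial *)

Section Character.
Variables (F : finFieldType) (K : closedFieldType) (emb : {rmorphism F -> K}).
Local Notation q := #|F|.
Local Notation "h ^i" := (map_poly emb h) (at level 2, format "h ^i").
Hypothesis q_odd : odd q.

Definition sgn (x : K) : int := if x == 1 then 1 else if x == -1 then -1 else 0.

(** Euler's criterion: on [Froots n] this is the quadratic character of the field with [q ^ n]
    elements, as the halved odd number is [(q ^ n - 1) / 2]. *)
Definition eta n (x : K) : int := sgn (x ^+ (q ^ n)./2).

Lemma oneN1 : (1 == -1 :> K) = false.
Proof.
have [p [m [pK qE m0]]] := finField_card_pchar emb.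
rewrite -addr_eq0 -[1 + 1]/(2%:R) -(dvdn_pcharf pK).
apply/negP => /(dvdn_leq (ltn0Sn 1)) p2.
have p_pr := pcharf_prime pK.
have pE : p = 2%N by apply/eqP; rewrite eqn_leq p2 prime_gt1.
by move: q_odd; rewrite qE pE oddX orbF => /eqP m00; rewrite m00 in m0.
Qed.

Lemma sgnM x y : x \in [:: 0; 1; -1] -> y \in [:: 0; 1; -1] ->
  sgn (x * y) = sgn x * sgn y.
Proof.
have n01 : (0 == 1 :> K) = false by rewrite eq_sym oner_eq0.
have n0N : (0 == -1 :> K) = false by rewrite eq_sym oppr_eq0 oner_eq0.
rewrite !inE => /or3P[]/eqP-> /or3P[]/eqP->; rewrite /sgn ?(mul0r, mulr0, mulr1, mul1r, mulrNN);
  by rewrite ?(eqxx, n01, n0N, oneN1, eq_sym (-1) 1).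
Qed.

Lemma qX_odd n : odd (q ^ n). Proof. by rewrite oddX q_odd orbT. Qed.

Lemma eta_val n x : (0 < n)%N -> x \in Froots F K n ->
  x ^+ (q ^ n)./2 \in [:: 0; 1; -1].
Proof.
move=> n0; rewrite mem_Froots // => /eqP xn.
have := odd_double_half (q ^ n); rewrite qX_odd add1n => eq_q.
have [->|x0] := eqVneq x 0.
  rewrite expr0n inE -(inj_eq double_inj) -eqSS eq_q.
  by have := ltn_exp2l 0 n (q_gt1 F); rewrite n0 => /gtn_eqF ->; rewrite eqxx.
have : (x ^+ (q ^ n)./2) ^+ 2 = 1.
  by apply: (mulfI x0); rewrite -exprM muln2 -exprS eq_q xn mulr1.
move/eqP; rewrite sqrf_eq1 => /orP[]/eqP ->; by rewrite !inE eqxx ?orbT.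
Qed.

Lemma etaM n x y : (0 < n)%N -> x \in Froots F K n -> y \in Froots F K n ->
  eta n (x * y) = eta n x * eta n y.
Proof. by move=> n0 xn yn; rewrite /eta exprMn sgnM ?eta_val. Qed.

(** Factors the Euler exponent through the norm to [F], whose exponent is the geometric sum. *)
Lemma half_qX n : (q ^ n)./2 = (q./2 * \sum_(i < n) q ^ i)%N.
Proof.
apply: double_inj; apply: succn_inj; rewrite doubleMl.
have := odd_double_half (q ^ n); rewrite qX_odd add1n => ->.
have := odd_double_half q; rewrite q_odd add1n => /(congr1 predn) /= ->.
by rewrite -predn_exp prednK ?qX_gt0.
Qed.

Lemma horner_norm (h : {poly F}) x k :
  h^i.[x] ^+ (\sum_(i < k) q ^ i) = \prod_(i < k) h^i.[x ^+ (q ^ i)].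
Proof. by rewrite expr_sum; apply: eq_bigr => i _; rewrite frob_horner. Qed.

(** * Monic polynomials of a given degree *)

Definition monics n : seq {poly F} := [seq 'X^n + (r : {poly F}) | r : {poly_n F}].

Lemma mem_monics n h : (h \in monics n) = (size h == n.+1) && (h \is monic).
Proof.
apply/mapP/andP => [[r _ ->]|[/eqP szh h_mon]].
  have ltr : (size (r : {poly F}) < size ('X^n : {poly F}))%N.
    by rewrite size_polyXn ltnS size_npoly.
  by rewrite size_polyDl // size_polyXn eqxx monicE lead_coefDl // lead_coefXn.
have szr : (size (h - 'X^n)%R <= n)%N.
  apply/leq_sizeP => j lenj; rewrite coefB coefXn; case: eqP => [->|/eqP ne].
    by move: h_mon; rewrite monicE /lead_coef szh => /eqP ->; rewrite subrr.
  by rewrite subr0 nth_default // szh ltn_neqAle eq_sym ne.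
by exists (npolyp n (h - 'X^n)); rewrite ?mem_enum // npolypK // addrC subrK.
Qed.

Lemma monics_uniq n : uniq (monics n).
Proof. by rewrite map_inj_uniq ?enum_uniq // => r1 r2 /addrI/val_inj. Qed.

Lemma monics0 : perm_eq (monics 0) [:: 1].
Proof.
apply: uniq_perm; rewrite ?monics_uniq // => h; rewrite mem_monics inE.
apply/andP/eqP => [[/eqP sz h_mon]|->]; last by rewrite size_poly1 monic1.
have := size1_polyC (eq_leq sz) => eqh; rewrite eqh in h_mon *.
by move: h_mon; rewrite monicE lead_coefC => /eqP ->.
Qed.

Lemma monics_dvd P m n : P \is monic -> size P = m.+1 -> (m <= n)%N ->
  perm_eq [seq h <- monics n | P %| h] [seq P * h | h <- monics (n - m)].
Proof.
move=> P_mon szP lemn; have P0 := monic_neq0 P_mon.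
apply: uniq_perm; first by rewrite filter_uniq ?monics_uniq.
  by rewrite map_inj_uniq ?monics_uniq //; exact: mulfI.
move=> h; rewrite mem_filter mem_monics; apply/andP/mapP => [[]|[g]].
  move=> /dvdpP[g ->] /andP[/eqP sz mon]; exists g; last by rewrite mulrC.
  have g_mon : g \is monic by rewrite mulrC monicMl in mon.
  rewrite mem_monics g_mon andbT; apply/eqP.
  move: sz; rewrite size_mul ?monic_neq0 // szP addnS /= => sz.
  by apply: (@addIn m); rewrite sz addSn subnK.
rewrite mem_monics => /andP[/eqP sz g_mon] ->.
rewrite dvdp_mulr // monicMl // g_mon size_mul ?monic_neq0 // szP sz addnS /=.
by rewrite addSn subnKC // eqxx.
Qed.

(** * The character at a root of an irreducible polynomial *)

Section Irreducible.
Variables (f : {poly F}) (al : K) (d : nat).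
Hypotheses (f_irr : irreducible_poly f) (f_monic : f \is monic).
Hypotheses (size_f : size f = d.+1) (al_root : root f^i al).
Hypothesis d_even : ~~ odd d.

(** The orbit product of [al] over its exact period divides [f], so equals it; the period is then
    [d], and the conjugates are distinct. *)
Lemma irreducible_conjprod : [/\ al \in Froots F K d, f^i = conjprod F al d & mup al f^i = 1%N].
Proof.
have f0 := monic_neq0 f_monic.
have [n [n0 ltn aln]] := root_period f0 al_root.
have [m [/andP[m0 lemn] alm minm um]] := min_period emb n0 aln.
have P_dv := Fconjprod_dvd m0 alm um al_root.
have szP := size_Fconjprod emb m0 alm.
have Pf : Fconjprod emb al m = f.
  have : Fconjprod emb al m %= f by apply: f_irr.2 => //; rewrite szP; case: (m) m0.
  by rewrite eqp_monic ?Fconjprod_monic // => /eqP.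
have dm : d = m by apply: succn_inj; rewrite -size_f -Pf szP.
by rewrite dm -Pf FconjprodK // mup_conjprod.
Qed.

Let d_gt0 : (0 < d)%N.
Proof. by have := f_irr.1; rewrite size_f. Qed.

Definition chi (h : {poly F}) : int := eta d h^i.[al].

Lemma horner_Froots (h : {poly F}) n b : (0 < n)%N -> b \in Froots F K n ->
  h^i.[b] \in Froots F K n.
Proof.
by move=> n0; rewrite !mem_Froots // => /eqP bn; rewrite frob_horner bn.
Qed.

Lemma chiM g h : chi (g * h) = chi g * chi h.
Proof.
have [ald _ _] := irreducible_conjprod.
by rewrite /chi rmorphM hornerM etaM ?horner_Froots.
Qed.

(* Quadratic reciprocity: both sides are computed from the resultant of [f]
   and [Fconjprod b k], which is symmetric because [d] is even. *)
Lemma chi_Fconjprod b k : (0 < k)%N -> b \in Froots F K k ->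
  chi (Fconjprod emb b k) = eta k f^i.[b].
Proof.
move=> k0 bk; have [ald fE _] := irreducible_conjprod.
rewrite /chi /eta !half_qX ![(q./2 * _)%N]mulnC !exprM !horner_norm.
congr (sgn (_ ^+ _)); rewrite FconjprodK // fE /conjprod.
under eq_bigr do rewrite horner_prod; rewrite exchange_big /=.
apply: eq_bigr => i _; rewrite horner_prod.
transitivity (\prod_(j < d) (- ((b ^+ (q ^ i)) - al ^+ (q ^ j)))).
  by apply: eq_bigr => j _; rewrite hornerXsubC opprB.
rewrite prodrN card_ord -signr_odd (negPf d_even) mul1r.
by apply: eq_bigr => j _; rewrite hornerXsubC.
Qed.

(* [coefL n] is the [n]-th coefficient of the L-polynomial. *)
Definition coefL n : int := \sum_(h <- monics n) chi h.
Definition psumL k : int := \sum_(b <- Froots F K k) eta k f^i.[b].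

Lemma chi1 : chi 1 = 1.
Proof. by rewrite /chi rmorph1 hornerC /eta expr1n /sgn eqxx. Qed.

Lemma coefL0 : coefL 0 = 1.
Proof. by rewrite /coefL (perm_big _ monics0) big_seq1 chi1. Qed.

(** The analogue of summing the von Mangoldt function over divisors: the degree is the sum of the
    multiplicities of the roots, each of which counts orbit products dividing [h]. *)
Lemma degree_count n h : h \in monics n ->
  n = (\sum_(1 <= k < n.+1) \sum_(b <- Froots F K k) (Fconjprod emb b k %| h)%R)%N.
Proof.
rewrite mem_monics => /andP[/eqP szh h_mon]; have h0 := monic_neq0 h_mon.
pose B := undup (flatten [seq Froots F K k | k <- iota 1 n]).
have memB b k : (0 < k < n.+1)%N -> b \in Froots F K k -> b \in B.
  move=> ltk bk; rewrite mem_undup; apply/flatten_mapP; exists k => //.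
  by rewrite mem_iota add1n.
transitivity (\sum_(b <- B) mup b h^i)%N.
  rewrite sum_mup ?undup_uniq ?map_poly_eq0 ?size_map_poly ?szh // => z.
  by case/(root_period h0) => k [k0 ltk zk]; apply: (memB _ k); rewrite // k0 -szh.
under eq_bigr do rewrite (@mup_count _ _ _ _ n _ h0) ?szh //.
rewrite exchange_big /= big_nat [RHS]big_nat; apply: eq_bigr => k ltk.
have k0 : (0 < k)%N by case/andP: ltk.
transitivity (\sum_(b <- B | b \in Froots F K k) (Fconjprod emb b k %| h)%R)%N.
  by rewrite [RHS]big_mkcond; apply: eq_bigr => b _; case: ifP.
rewrite -big_filter; apply/perm_big/uniq_perm => [||b].
- by rewrite filter_uniq ?undup_uniq.
- exact: Froots_uniq emb _ k0.
- rewrite mem_filter; case: (boolP (b \in _)) => //= bk.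
  exact: memB bk.
Qed.

(** The factor [n] is expanded by [degree_count]. The terms with a fixed divisor
    [P = Fconjprod emb b k] are those [h = P g], and [chi P] is given by reciprocity. *)
Lemma coefL_newton n :
  n%:R * coefL n = \sum_(k < n) psumL k.+1 * coefL (n - k.+1)%N.
Proof.
have dvd_sum b k : (0 < k < n.+1)%N -> b \in Froots F K k ->
    \sum_(h <- monics n) (Fconjprod emb b k %| h)%R%:R * chi h =
    eta k f^i.[b] * coefL (n - k)%N.
  move=> /andP[k0 ltk] bk.
  transitivity (\sum_(h <- [seq h <- monics n | Fconjprod emb b k %| h]) chi h).
    rewrite big_filter [RHS]big_mkcond; apply: eq_bigr => h _.
    by case: ifP => _; rewrite ?mul1r ?mul0r.
  rewrite (perm_big _ (monics_dvd _ (size_Fconjprod emb k0 bk) _)) ?Fconjprod_monic //.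
  rewrite big_map -chi_Fconjprod // mulr_sumr.
  by apply: eq_bigr => h _; rewrite chiM.
transitivity (\sum_(1 <= k < n.+1) psumL k * coefL (n - k)%N); last first.
  by rewrite big_add1 big_mkord.
transitivity (\sum_(1 <= k < n.+1) \sum_(b <- Froots F K k)
    \sum_(h <- monics n) (Fconjprod emb b k %| h)%R%:R * chi h).
  rewrite /coefL mulr_sumr.
  under [RHS]eq_bigr do rewrite exchange_big.
  rewrite exchange_big big_seq [RHS]big_seq; apply: eq_bigr => h hn.
  rewrite {1}(degree_count hn) natr_sum mulr_suml; apply: eq_bigr => k _.
  by rewrite natr_sum mulr_suml.
rewrite big_nat [RHS]big_nat; apply: eq_bigr => k ltk.
by rewrite mulr_suml big_seq [RHS]big_seq; apply: eq_bigr => b; exact: dvd_sum.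
Qed.

(* For [d <= n], multiplying the residue of [h] modulo [f] by 'X permutes the
   monic polynomials of degree [n] and changes the sign of [chi h]. *)
Lemma coefL_eq0 n : chi 'X = -1 -> (d <= n)%N -> coefL n = 0.
Proof.
move=> chiX ledn.
pose phi (h : {poly F}) : {poly F} := h %/ f * f + ('X * (h %% f)) %% f.
have f0 := monic_neq0 f_monic.
have al0 : al != 0.
  apply/eqP => al0; move: chiX; rewrite /chi map_polyX hornerX al0.
  rewrite /eta expr0n; case: (_ == _); rewrite /sgn ?eqxx //.
  by rewrite eq_sym oner_eq0 eq_sym oppr_eq0 oner_eq0.
have falE (h : {poly F}) : (h %% f)^i.[al] = h^i.[al].
  by rewrite {2}(divp_eq h f) rmorphD rmorphM hornerD hornerM (rootP al_root) mulr0 add0r.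
have chi_phi h : chi (phi h) = - chi h.
  rewrite -mulN1r -chiX -chiM /chi rmorphD rmorphM hornerD hornerM (rootP al_root).
  by rewrite mulr0 add0r falE rmorphM !hornerM falE rmorphM hornerM.
have sz_mod h : (size (h %% f)%R <= d)%N by rewrite -ltnS -size_f ltn_modp.
(* Only coefficients below degree [d <= n] change, so the leading term survives. *)
have phi_in : {subset map phi (monics n) <= monics n}.
  move=> _ /mapP[h hn ->]; move: hn; rewrite !mem_monics => /andP[/eqP szh h_mon].
  have -> : phi h = h + (('X * (h %% f)) %% f - h %% f).
    by apply: (@addIr _ (h %% f)); rewrite -[RHS]addrA subrK /phi addrAC -divp_eq.
  have lt_sz : (size (('X * (h %% f)) %% f - h %% f)%R < size h)%N.
    rewrite szh ltnS (leq_trans _ ledn) // (leq_trans (size_polyD _ _)) //.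
    by rewrite geq_max size_polyN !sz_mod.
  by rewrite size_polyDl // szh eqxx monicE lead_coefDl.
(* The quotient can be read off from [phi h]; the residue, of degree below [d], is determined by its
   value at the nonzero root [al]. *)
have phi_inj : injective phi.
  move=> h h' eqphi.
  have lt_f (g : {poly F}) : (size ('X * (g %% f) %% f)%R < size f)%N by rewrite ltn_modp.
  have := congr1 (fun g => g %/ f) eqphi; rewrite /= !divp_addl_mul_small // => eqd.
  rewrite (divp_eq h f) (divp_eq h' f) eqd; congr (_ + _).
  have := congr1 (fun g => (g^i).[al]) eqphi.
  rewrite /phi !rmorphD !rmorphM !hornerD !hornerM (rootP al_root) !mulr0 !add0r.
  rewrite !falE !rmorphM !hornerM /= map_polyX !hornerX => /(mulfI al0) eqal.
  apply/eqP; rewrite -subr_eq0; apply/negPn/negP => r0.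
  have : coprimep f (h %% f - h' %% f).
    rewrite irreducible_poly_coprime //; apply/negP => /(dvdp_leq r0).
    rewrite size_f leqNgt ltnS (leq_trans (size_polyD _ _)) //.
    by rewrite geq_max size_polyN !sz_mod.
  rewrite -(coprimep_map emb) => /coprimep_root/(_ al_root).
  by rewrite rmorphB hornerD hornerN eqal subrr eqxx.
have phi_perm : perm_eq (map phi (monics n)) (monics n).
  have u : uniq (map phi (monics n)) by rewrite map_inj_uniq ?monics_uniq.
  have [|_ e] := uniq_min_size u phi_in; first by rewrite (size_map phi).
  by apply: uniq_perm; rewrite ?monics_uniq.
have : coefL n = - coefL n.
  rewrite {1}/coefL -(perm_big _ phi_perm) big_map /coefL -sumrN.
  by apply: eq_bigr => h _; rewrite chi_phi.
by lia.
Qed.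

End Irreducible.

End Character.

(** * Weil's bound and superirreducibility *)

Section Weil.
Variables (F : finFieldType) (K : closedFieldType) (emb : {rmorphism F -> K}).
Local Notation q := #|F|.
Local Notation "h ^i" := (map_poly emb h) (at level 2, format "h ^i").
Hypothesis q_odd : odd q.
Variables (f : {poly F}) (al : K) (d : nat).
Hypotheses (f_irr : irreducible_poly f) (f_monic : f \is monic).
Hypotheses (size_f : size f = d.+1) (al_root : root f^i al).
Hypothesis d_even : ~~ odd d.

(** Stepanov bounds from above how often each of the values 1 and -1 occurs. Since the three counts
    add up to [R ^ 2] and 0 occurs at most [d] times, their difference is bounded on both sides;
    hence [11 = 10 + 1]. *)
Lemma psumL_even_bound k : (0 < k)%N ->
  `|psumL emb f k.*2| <= (11 * d)%:R * q%:R ^+ k.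
Proof.
move=> k0; have [_ _ mup1] := irreducible_conjprod f_irr f_monic size_f al_root.
pose Q := Froots F K k.*2; pose R := (q ^ k)%N.
have kk0 : (0 < k.*2)%N by rewrite double_gt0.
have RQ : (q ^ k.*2 = R ^ 2)%N by rewrite -expnM muln2.
pose N e := count (fun b => f^i.[b] ^+ (R ^ 2)./2 == e) Q.
have R2 := odd_double_half R; rewrite qX_odd // add1n in R2.
have r0 : (0 < R./2)%N.
  have : (1 < R)%N by have := ltn_exp2l 0 k (q_gt1 F); rewrite k0.
  by rewrite -{1}R2 ltnS double_gt0.
have step e : ((N e).*2 <= R ^ 2 + 10 * d * R)%N.
  have := @stepanov_bound K f^i al e R./2 d.
  rewrite R2 card_pchar_nat // size_map_poly /N -size_filter; apply=> //.
    by rewrite filter_uniq ?Froots_uniq.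
  move=> c; rewrite mem_filter mem_Froots // -RQ => /andP[/eqP fc /eqP cQ].
  by split.
have N0 : (N 0%R <= d)%N.
  have f0 : f^i != 0 by rewrite map_poly_eq0 monic_neq0.
  rewrite -ltnS -size_f -(size_map_poly emb) /N -size_filter.
  apply: max_poly_roots => //; last by rewrite filter_uniq ?Froots_uniq.
  by apply/allP => c; rewrite mem_filter expf_eq0 => /andP[/andP[_ ?] _].
have n01 : (0 == 1 :> K) = false by rewrite eq_sym oner_eq0.
have n0N : (0 == -1 :> K) = false by rewrite eq_sym oppr_eq0 oner_eq0.
have nN1 : (-1 == 1 :> K) = false by rewrite eq_sym (oneN1 emb).
have val b : b \in Q -> f^i.[b] ^+ (R ^ 2)./2 \in [:: 0; 1; -1].
  by move=> bQ; rewrite -RQ; apply: eta_val => //; exact: horner_Froots.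
have NE e : N e = (\sum_(b <- Q) (f^i.[b] ^+ (R ^ 2)./2 == e))%N.
  by rewrite /N -sum1_count big_mkcond; apply: eq_bigr => b _; case: (_ == e).
have total : (N 0%R + N 1%R + N (-1)%R = R ^ 2)%N.
  rewrite -RQ -(size_Froots F K kk0) -/Q -sum1_size !NE -!big_split /=.
  rewrite big_seq [RHS]big_seq; apply: eq_bigr => b /val; rewrite !inE.
  move=> /or3P[]/eqP ->;
    by rewrite ?(eqxx, n01, n0N, nN1, oneN1 emb, oner_eq0, oppr_eq0).
have sE : psumL emb f k.*2 = (N 1)%:R - (N (-1))%:R.
  rewrite /psumL !NE !natr_sum -sumrN -big_split /= big_seq [RHS]big_seq.
  apply: eq_bigr => b /val; rewrite /eta RQ /sgn !inE => /or3P[]/eqP ->;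
    by rewrite ?(eqxx, n01, n0N, nN1, oneN1 emb, oner_eq0, oppr_eq0).
rewrite sE -natrX -/R; have := step 1; have := step (-1).
have dR : (d <= d * R)%N by rewrite leq_pmulr // qX_gt0.
rewrite -mulnA; lia.
Qed.

Lemma weil_bound : chi emb al d 'X = -1 ->
  psumL emb f 1 ^+ 2 <= d.-1%:R ^+ 2 * q%:R.
Proof.
move=> chiX.
have newton := coefL_newton q_odd f_irr f_monic size_f al_root d_even.
have a0 : coefL emb al d 0 = 1 := coefL0 emb al d.
have d0 : (0 < d)%N by have := f_irr.1; rewrite size_f.
have -> : psumL emb f 1 = coefL emb al d 1.
  by rewrite -[RHS]mul1r (newton 1%N) big_ord1 subnn a0 mulr1.
apply: (newton_weil_bound (s := psumL emb f) (C := 11 * d)) => //.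
- exact: ltnW (q_gt1 F).
- by move=> n; apply: (coefL_eq0 q_odd f_irr f_monic size_f al_root _ chiX).
- exact: psumL_even_bound.
Qed.

(* If [f(c)] is a nonzero square in [F], then so is [al - c] in the field
   [F(al)]; a square root of it is a root of [f \Po ('X^2 + c)] of degree at
   most [d] over [F]. *)
Lemma superirreducible2_eta c : (0 < d)%N -> superirreducible2 f ->
  eta F 1 f^i.[emb c] = -1.
Proof.
move=> d0 f_super.
have [ald fE _] := irreducible_conjprod f_irr f_monic size_f al_root.
have cF : emb c \in Froots F K 1 by rewrite mem_Froots // frob_emb.
have := eta_val q_odd (ltn0Sn 0) (horner_Froots emb f (ltn0Sn 0) cF).
have recip := chi_Fconjprod q_odd f_irr f_monic size_f al_root d_even (ltn0Sn 0) cF.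
rewrite !inE => /or3P[]/eqP fc.
(* A root in [F] would force [d = 1], against parity. *)
- have fc0 : f.[c] = 0.
    apply: (fmorph_inj emb); rewrite rmorph0 -horner_map.
    by apply/eqP; move/eqP: fc; rewrite expf_eq0 => /andP[].
  have := f_irr.2 ('X - c%:P); rewrite size_XsubC dvdp_XsubCl /root fc0 eqxx.
  move=> /(_ isT isT) /eqp_size; rewrite size_XsubC size_f => [][d1].
  by move: d_even; rewrite -d1.
(* Reciprocity for the linear polynomial [X - c] carries the square condition from [f(c)] to
   [al - c]. *)
- have : sgn ((al - emb c) ^+ (q ^ d)./2) = 1.
    have eta1 : eta F 1 f^i.[emb c] = 1 by rewrite /eta fc /sgn eqxx.
    rewrite -eta1 -recip /chi FconjprodK // /conjprod big_ord1 hornerXsubC.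
    by rewrite expn0 expr1.
  rewrite /sgn; case: eqP => [sq _|_]; last by case: ifP.
  have [be be2] : exists be, be ^+ 2 = al - emb c.
    have /closed_rootP[be] : size ('X^2 - (al - emb c)%:P) != 1%N.
      by rewrite size_XnsubC.
    by rewrite /root !hornerE subr_eq0 => /eqP; exists be.
  have bed : be \in Froots F K d.
    rewrite mem_Froots //; have := odd_double_half (q ^ d).
    by rewrite qX_odd // add1n => <-; rewrite exprS -mul2n exprM be2 sq mulr1.
  pose g : {poly F} := 'X^2 + c%:P.
  have szg : size g = 3 by rewrite size_XnaddC.
  have h_irr := f_super g (or_intror szg).
  have szh : size (f \Po g) = d.*2.+1.
    have := size_comp_poly f g; rewrite size_f szg /= muln2 => <-.
    by rewrite prednK // ltnW // h_irr.1.
  have h_root : root (f \Po g)^i be.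
    rewrite map_comp_poly /root horner_comp /g rmorphD /= map_polyXn map_polyC /=.
    by rewrite !hornerE be2 subrK; exact: al_root.
  have Q_root : root (Fconjprod emb be d)^i be by rewrite FconjprodK ?root_conjprod.
  (* An irreducible polynomial of degree [2 d] cannot divide a nonzero one of degree [d], yet [be]
     is a common root. *)
  have : coprimep (f \Po g) (Fconjprod emb be d).
    rewrite irreducible_poly_coprime //; apply/negP.
    move=> /(dvdp_leq (monic_neq0 (Fconjprod_monic emb d0 bed))).
    by rewrite szh size_Fconjprod // ltnS -addnn -[leqRHS]addn0 leq_add2l leqNgt d0.
  rewrite -(coprimep_map emb) => /coprimep_root/(_ h_root).
  by rewrite (rootP Q_root) eqxx.
by rewrite /eta fc /sgn eqxx eq_sym (oneN1 emb).
Qed.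

End Weil.

Lemma superirreducible2_small (F : finFieldType) (f : {poly F}) (d : nat) :
  odd #|F| -> (0 < d)%N -> ~~ odd d -> f \is monic -> size f = d.+1 ->
  superirreducible2 f -> (#|F| <= d.-1 ^ 2)%N.
Proof.
move=> q_odd d0 d_even f_monic size_f f_super.
have f_irr : irreducible_poly f.
  by rewrite -[f]comp_polyXr; apply: f_super; left; rewrite size_polyX.
have [K [emb _]] := countable_algebraic_closure F.
have [al al_root] : exists al, root (map_poly emb f) al.
  by apply/closed_rootP; rewrite size_map_poly size_f; case: (d) d0.
have etaN c := superirreducible2_eta q_odd f_irr f_monic size_f al_root d_even c d0 f_super.
have F0 : 0 \in Froots F K 1 by rewrite mem_Froots // expr0n gtn_eqF ?qX_gt0 //= eqxx.
(* [X] is the orbit product of 0, so by reciprocity its character is that of [f(0)], a nonsquare. *)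
have chiX : chi emb al d 'X = -1.
  have := chi_Fconjprod q_odd f_irr f_monic size_f al_root d_even (ltn0Sn 0) F0.
  rewrite -{2}(rmorph0 emb) etaN => <-; congr chi.
  apply: (map_poly_inj emb); rewrite FconjprodK // /conjprod big_ord1 map_polyX.
  by rewrite expn0 expr1 subr0.
have := weil_bound q_odd f_irr f_monic size_f al_root d_even chiX.
have -> : psumL emb f 1 = - #|F|%:R.
  rewrite -(expn1 #|F|) -(size_Froots F K (ltn0Sn 0)) -sum1_size natr_sum -sumrN.
  rewrite /psumL big_seq [RHS]big_seq; apply: eq_bigr => b.
  by rewrite mem_Froots // expn1 => /eqP/(frob_fixed emb)[a <-].
(* Weil's bound now reads [q ^ 2 <= (d - 1) ^ 2 q], and one factor [q] cancels. *)
rewrite sqrrN expr2 ler_pM2r ?ltr0n ?(ltnW (q_gt1 F)) //.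
by rewrite -natrX ler_nat.
Qed.

Local Close Scope ring_scope.

Theorem theorem3p9 (F : finFieldType) (q p k d : nat)
    (p_prime : prime p) (k_gt0 : 0 < k) (q_def : q = p ^ k) (q_odd : odd q)
    (card_F : #|F| = q) (d_gt0 : 0 < d) (d_even : ~~ odd d)
    (q_large : (d - 1) ^ 2 < q) :
  s2 F d = 0.
Proof.
apply/eqP; rewrite cards_eq0; apply/eqP/setP => f; rewrite !inE.
apply/negP => /and3P[/eqP size_f f_monic /boolp.asboolP f_super].
rewrite -card_F in q_odd q_large.
have := superirreducible2_small q_odd d_gt0 d_even f_monic size_f f_super.
by rewrite -subn1 leqNgt q_large.
Qed.
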